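(* Let $G=(V,E,W)$ be a network with noise-corrupted leader dynamics, and let $S\subseteq V$, $S\ne\emptyset$, be the set of leaders. Let $\overline G=(\overline V,\overline E,\overline W)$ be the corresponding augmented graph, with added node $\overline s$. Then the coherence of $G$ is $$ R_{NC}(S)=\frac12\sum_{i\in V}\overline r(i,\overline s), $$ where $\overline r(u,v)$ denotes the resistance distance between $u$ and $v$ in $\overline G$.
   Context: $G=(V,E,W)$ is a finite, undirected, connected graph with positive edge weights $w_{ij}$; $W$ is the symmetric weighted adjacency matrix, $D$ the diagonal matrix with entries $\sum_j w_{ij}$, and $L=D-W$ the weighted Laplacian. Noise-corrupted leader dynamics: every follower $i\in V\setminus S$ satisfies $\dot x_i=-\sum_{j\in\mathcal N(i)}w_{ij}(x_i-x_j)+d_i$ and every leader $i\in S$ satisfies $\dot x_i=-\sum_{j\in\mathcal N(i)}w_{ij}(x_i-x_j)-\kappa_i x_i+d_i$, where $\mathcal N(i)$ is the neighbor set of $i$, $\kappa_i>0$ is the degree of stubbornness of $i$, and the $d_i$ are zero-mean, unit-variance white noise processes. Let $D_\kappa$ be the diagonal matrix with entries $\kappa_i$ and $D_S$ the diagonal $0/1$ matrix whose $(i,i)$ entry is $1$ iff $i\in S$. The coherence is the total steady-state variance of all nodes, which is given by $$R_{NC}(S)=\tfrac12\operatorname{tr}\big((L+D_\kappa D_S)^{-1}\big).$$ Augmented graph: $\overline G$ is obtained from $G$ by adding a single node $\overline s$ and, for each $i\in S$, an edge $(i,\overline s)$ of weight $\kappa_i$. Resistance distance: in a weighted graph, regard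 each edge of weight $w$ as a resistor of resistance $1/w$; the resistance distance between two nodes is the potential difference between them when a unit current is applied between them. *)

(* Defs.v *)
From HB Require Import structures.
From mathcomp Require Import all_boot all_order all_algebra.
From mathcomp Require Import boolp classical_sets.

Set Implicit Arguments.
Unset Strict Implicit.
Unset Printing Implicit Defensive.

Import Order.TTheory GRing.Theory Num.Theory.
Local Open Scope ring_scope.

(* A weighted graph on T is given by its weight function: {x, y} is an edge
   iff w x y is nonzero, and w x y is then its weight.  Loops are not excluded;
   they change neither the Laplacian nor the resistance distance. *)
Section WeightedGraph.
Variables (R : realFieldType) (T : finType) (w : T -> T -> R).

Definition edge : rel T := fun x y => w x y != 0.

Definition connected_wgraph : Prop :=
  [/\ forall x y, w x y = w y x,
      forall x y, edge x y -> 0 < w x y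
    & forall x y, connect edge x y].

(* Ohm's law: an edge of weight w x y has resistance (w x y)^-1. *)
Definition edge_current (p : T -> R) (x y : T) : R := w x y * (p x - p y).

(* Kirchhoff's current law for a unit current entering at u, leaving at v. *)
Definition unit_current_potential (u v : T) (p : T -> R) : Prop :=
  forall x, \sum_y edge_current p x y = (x == u)%:R - (x == v)%:R.

(* The potential is unique only up to an additive constant on each component,
   but p u - p v is well defined when u and v are connected; the default
   value 0 is used only when no unit current can flow from u to v. *)
Definition resistance (u v : T) : R :=
  xget 0 [set r | exists2 p, unit_current_potential u v p
                           & r = p u - p v]%classic.

End WeightedGraph.

Section NoiseCorruptedLeaders.
Variables (R : realFieldType) (n : nat).
Variables (W : 'M[R]_n) (S : {set 'I_n}) (kappa : 'I_n -> R).

Definition degree_mx : 'M[R]_n := diag_mx (\row_i \sum_j W i j).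

Definition laplacian : 'M[R]_n := degree_mx - W.

Definition stubbornness_mx : 'M[R]_n := diag_mx (\row_i kappa i).

Definition leader_mx : 'M[R]_n := diag_mx (\row_i (i \in S)%:R).

(* Total steady-state variance of the dynamics
   x' = - (laplacian + stubbornness_mx *m leader_mx) x + d, where d is a
   vector of zero-mean, unit-variance white noise processes, given by its
   closed form.  The inverse is genuine when the graph is connected, S is
   nonempty and kappa is positive on S. *)
Definition coherence : R :=
  2^-1 * \tr (invmx (laplacian + stubbornness_mx *m leader_mx)).

(* Some i is the node i of the original graph, None is the added node. *)
Definition augmented_weight (a b : option 'I_n) : R :=
  match a, b with
  | Some i, Some j => W i j
  | Some i, None | None, Some i => if i \in S then kappa i else 0
  | None, None => 0
  end.

End NoiseCorruptedLeaders.

(* Main.v *)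
Require Import Defs.
From HB Require Import structures.
From mathcomp Require Import all_boot all_order all_algebra.
From mathcomp Require Import boolp classical_sets.

Set Implicit Arguments.
Unset Strict Implicit.
Unset Printing Implicit Defensive.

Import Order.TTheory GRing.Theory Num.Theory.
Local Open Scope ring_scope.

(** Ground the added node, that is, give it potential 0.  The matrix
    [M := laplacian W + stubbornness_mx kappa *m leader_mx R S] of the dynamics
    then maps the potentials of the nodes of the graph to the currents that
    leave these nodes in the augmented graph ([grounded_currentE]): a leader
    loses the additional current [kappa i * v i] to the ground, which is exactly
    the stubbornness term.  So column [i] of [invmx M] is the potential created
    by a unit current from node [i] to the ground (by conservation of charge,
    the current reaches the added node), and its entry [i] is the potential drop
    from [i] to the ground, that is, the resistance distance.  Summing over [i]
    gives the trace.

    Two facts make this rigorous, namely that [M] is invertible and that the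
    potential drop is the same for all potentials that satisfy Kirchhoff's law.
    Both follow from [source_free_constant]: on a connected graph, a potential
    without sources dissipates no energy, so it is constant.  [green_identity]
    gives this energy argument as well as the conservation of charge. *)

Lemma sum_option (V : nmodType) (T : finType) (F : option T -> V) :
  \sum_a F a = F None + \sum_i F (Some i).
Proof.
rewrite (bigD1 None) //= (reindex_omap Some id) => [|[]//] /=; congr (_ + _).
by apply: eq_bigl => i; rewrite eqxx.
Qed.

Section CurrentsOnGraph.
Variables (R : realFieldType) (T : finType) (w : T -> T -> R).
Hypothesis w_sym : forall x y, w x y = w y x.

(** Summation by parts: an edge contributes to the left-hand side once from each
    of its ends, with opposite currents. *)
Lemma green_identity (f p : T -> R) :
  2 * \sum_x f x * \sum_y edge_current w p x y =
    \sum_x \sum_y w x y * ((f x - f y) * (p x - p y)).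
Proof.
have swapE : \sum_x f x * \sum_y edge_current w p x y =
             \sum_x \sum_y - f y * edge_current w p x y.
  rewrite exchange_big /=; apply: eq_bigr => x _.
  rewrite mulr_sumr; apply: eq_bigr => y _.
  by rewrite /edge_current [w y x]w_sym mulNr -mulrN -mulrN opprB.
rewrite mulr_natl mulr2n {2}swapE -big_split; apply: eq_bigr => x _.
rewrite /= mulr_sumr -big_split; apply: eq_bigr => y _.
by rewrite /= -mulrDl /edge_current mulrCA.
Qed.

Lemma total_current_eq0 (p : T -> R) : \sum_x \sum_y edge_current w p x y = 0.
Proof.
have := green_identity (fun=> 1) p.
rewrite [RHS]big1 => [/eqP|x _]; last first.
  by rewrite big1 // => y _; rewrite subrr mul0r mulr0.
rewrite mulf_eq0 pnatr_eq0 /= => /eqP sum0.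
by rewrite -[RHS]sum0; apply: eq_bigr => x _; rewrite mul1r.
Qed.

Lemma sum_edge_currentB (p q : T -> R) x :
  \sum_y edge_current w (fun z => p z - q z) x y =
    \sum_y edge_current w p x y - \sum_y edge_current w q x y.
Proof.
rewrite -sumrB; apply: eq_bigr => y _.
by rewrite /edge_current -mulrBr opprD addrACA -opprD.
Qed.

End CurrentsOnGraph.

Section ConnectedGraph.
Variables (R : realFieldType) (T : finType) (w : T -> T -> R).
Hypothesis w_graph : connected_wgraph w.

(** The energy [\sum_x \sum_y w x y * (p x - p y) ^+ 2] dissipated by [p] is
    twice the power fed in by the sources, hence 0; so [p] takes the same value
    at both ends of every edge. *)
Lemma source_free_constant (p : T -> R) :
  (forall x, \sum_y edge_current w p x y = 0) -> forall x y, p x = p y.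
Proof.
case: w_graph => w_sym w_gt0 w_conn p_free.
have energy_ge0 x y : 0 <= w x y * ((p x - p y) * (p x - p y)).
  have [->|/w_gt0/ltW w_ge0] := eqVneq (w x y) 0; first by rewrite mul0r.
  by rewrite mulr_ge0 // -expr2 sqr_ge0.
have energy0 : \sum_x \sum_y w x y * ((p x - p y) * (p x - p y)) = 0.
  rewrite -(green_identity w_sym) big1 ?mulr0 // => x _.
  by rewrite p_free mulr0.
have edge_eq x y : edge w x y -> p x = p y.
  move=> exy.
  have row0 : \sum_z w x z * ((p x - p z) * (p x - p z)) = 0.
    by apply: (psumr_eq0P _ energy0) => // z _; apply: sumr_ge0.
  have : w x y * ((p x - p y) * (p x - p y)) = 0.
    by apply: (psumr_eq0P _ row0) => // z _; apply: energy_ge0.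
  move/eqP; rewrite !mulf_eq0 (negPf (exy : w x y != 0)) orbb subr_eq0.
  by move/eqP.
move=> x y; have /connectP[s] := w_conn x y.
elim: s x => [|z s IHs] x /= => [_ -> // | /andP[/edge_eq-> szs]].
exact: IHs.
Qed.

Lemma resistanceE (u v : T) (p : T -> R) :
  unit_current_potential w u v p -> resistance w u v = p u - p v.
Proof.
move=> p_unit; apply: xget_unique => [|r [q q_unit ->]]; first by exists p.
have /source_free_constant/(_ u v) : forall x,
    \sum_y edge_current w (fun z => q z - p z) x y = 0.
  by move=> x; rewrite sum_edge_currentB q_unit p_unit subrr.
by move/eqP; rewrite subr_eq addrAC -addrA [eqbRHS]addrC -subr_eq => /eqP.
Qed.

End ConnectedGraph.

Section AugmentedGraph.
Variables (R : realFieldType) (n : nat).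
Variables (W : 'M[R]_n) (S : {set 'I_n}) (kappa : 'I_n -> R).
Hypothesis W_graph : connected_wgraph W.
Hypothesis S_neq0 : S != finset.set0.
Hypothesis kappa_gt0 : forall i, i \in S -> 0 < kappa i.

Local Notation aug := (augmented_weight W S kappa).
Local Notation M := (laplacian W + stubbornness_mx kappa *m leader_mx R S).

Lemma augmented_connected : connected_wgraph aug.
Proof.
case: W_graph => W_sym W_gt0 W_conn.
have aug_sym x y : aug x y = aug y x by case: x y => [i|] [j|] /=.
have aug_gt0 x y : edge aug x y -> 0 < aug x y.
  rewrite /edge; case: x y => [i|] [j|] //=; rewrite ?eqxx //; first exact: W_gt0.
  - by case: ifP => [/kappa_gt0|]; rewrite ?eqxx.
  - by case: ifP => [/kappa_gt0|]; rewrite ?eqxx.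
have connC : connect_sym (edge aug).
  by apply: sym_connect_sym => x y; rewrite /edge aug_sym.
have conn_Some i j : connect (edge aug) (Some i) (Some j).
  have /connectP[s Ws ->] := W_conn i j; apply/connectP.
  by exists (map Some s); rewrite ?last_map // path_map.
have conn_None i : connect (edge aug) (Some i) None.
  have /set0Pn[s sS] := S_neq0; apply: (connect_trans (conn_Some i s)).
  by apply: connect1; rewrite /edge /= sS gt_eqF // kappa_gt0.
by split=> // -[i|] [j|] //; rewrite connC.
Qed.

Definition grounded (v : 'cV[R]_n) (a : option 'I_n) : R :=
  if a is Some i then v i 0 else 0.

Lemma grounded_currentE (v : 'cV[R]_n) (i : 'I_n) :
  \sum_b edge_current aug (grounded v) (Some i) b = (M *m v) i 0.
Proof.
rewrite sum_option /edge_current /= subr0.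
rewrite mulmxDl mulmxBl -mulmxA !mul_diag_mx !mxE mulr_suml -sumrB [RHS]addrC.
congr (_ + _); last by apply: eq_bigr => j _; rewrite mulrBr.
by case: (i \in S); rewrite ?mul1r ?mul0r ?mulr0.
Qed.

Lemma ground_currentE (v : 'cV[R]_n) :
  \sum_b edge_current aug (grounded v) None b = - \sum_i (M *m v) i 0.
Proof.
have [aug_sym _ _] := augmented_connected.
have := total_current_eq0 aug_sym (grounded v).
rewrite (sum_option (fun a => \sum_b _)) => /eqP; rewrite addr_eq0 => /eqP ->.
by congr (- _); apply: eq_bigr => i _; rewrite grounded_currentE.
Qed.

(** A vector in the kernel of the matrix is a source-free potential that
    vanishes at the ground. *)
Lemma dynamics_mx_unit : M \in unitmx.
Proof.
rewrite -unitmx_tr -row_free_unit; apply: inj_row_free => v vM0.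
have Mv0 : M *m v^T = 0 by apply: trmx_inj; rewrite trmx_mul trmxK vM0 trmx0.
have v_const : forall a b, grounded v^T a = grounded v^T b.
  apply: source_free_constant augmented_connected _ _ => -[i|].
    by rewrite grounded_currentE Mv0 mxE.
  by rewrite ground_currentE Mv0 big1 ?oppr0 // => i _; rewrite mxE.
by apply/rowP => i; have := v_const (Some i) None; rewrite /= !mxE.
Qed.

Lemma resistance_to_ground (i : 'I_n) :
  resistance aug (Some i) None = invmx M i i.
Proof.
have MK j : (M *m col i (invmx M)) j 0 = (j == i)%:R.
  by rewrite colE mulmxA mulmxV ?dynamics_mx_unit // mul1mx mxE andbT.
rewrite (resistanceE augmented_connected (p := grounded (col i (invmx M)))).
  by rewrite /= subr0 mxE.
move=> [j|]; first by rewrite grounded_currentE MK subr0.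
rewrite ground_currentE (eq_bigr _ (fun j _ => MK j)) sub0r; congr (- _).
by rewrite (bigD1 i) //= eqxx big1 ?addr0 // => j /negPf->.
Qed.

End AugmentedGraph.

Theorem theorem3 (R : realFieldType) (n : nat) (W : 'M[R]_n)
    (S : {set 'I_n}) (kappa : 'I_n -> R)
    (W_graph : connected_wgraph W)
    (S_neq0 : S != finset.set0)
    (kappa_gt0 : forall i, i \in S -> 0 < kappa i) :
  coherence W S kappa =
    2^-1 * \sum_(i < n) resistance (augmented_weight W S kappa) (Some i) None.
Proof.
congr (_ * _); apply: eq_bigr => i _.
by rewrite resistance_to_ground.
Qed.
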